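(* Let $(\bar M,\bar g)$ be a Riemannian manifold and let $(\bar g,\bar J_1)$ and $(\bar g,\bar J_2)$ be two almost Hermitian structures on $\bar M$ with $\bar J_1\bar J_2=-\bar J_2\bar J_1$. Let $M$ be an immersed submanifold of $\bar M$ which, for $i=1,2$, is a pointwise slant submanifold of $(\bar M,\bar g,\bar J_i)$ with slant function $\theta_i$. Let $a,b$ be smooth functions on $\bar M$ with $a^2+b^2=1$, and let $\bar J_{a,b}:=a\bar J_1+b\bar J_2$. Then: (i) if $\theta_1=\theta_2=\frac{\pi}{2}$, then the slant function $\theta$ of $M$ in $(\bar M,\bar g,\bar J_{a,b})$ is $\theta=\frac{\pi}{2}$; that is, if $M$ is anti-invariant in $(\bar M,\bar g,\bar J_1)$ and in $(\bar M,\bar g,\bar J_2)$, then it is anti-invariant in $(\bar M,\bar g,\bar J_{a,b})$; (ii) if $\bar g(T_1X,T_2X)=0$ for any $X\in\Gamma(TM)$, then the slant function $\theta$ of $M$ in $(\bar M,\bar g,\bar J_{a,b})$ satisfies $$\min\{\theta_1,\theta_2\}\leq\theta\leq\max\{\theta_1,\theta_2\}.$$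
   Context: An almost complex structure on $\bar M$ is an endomorphism $\bar J$ of $T\bar M$ with $\bar J^2=-I$; if it is skew-symmetric with respect to $\bar g$, then $(\bar g,\bar J)$ is an almost Hermitian structure on $\bar M$ and $(\bar M,\bar g,\bar J)$ is an almost Hermitian manifold. If $(\bar g,\bar J_1)$ and $(\bar g,\bar J_2)$ are almost Hermitian structures on $\bar M$ with $\bar J_1\bar J_2=-\bar J_2\bar J_1$, and $a,b$ are smooth functions on $\bar M$ with $a^2+b^2=1$, then, for $\bar J_{a,b}:=a\bar J_1+b\bar J_2$, $(\bar g,\bar J_{a,b})$ is an almost Hermitian structure. All immersions are assumed injective, and the same symbol denotes a metric and the induced metric on a submanifold. $\Gamma(TM)$ is the set of smooth vector fields on $M$; for $X\in\Gamma(TM)$ write $\bar J_iX=T_iX+N_iX$, where $T_iX$ and $N_iX$ are the components of $\bar J_iX$ tangent and normal to $M$, respectively. An immersed submanifold $M$ of an almost Hermitian manifold $(\bar M,\bar g,\bar J)$ is a pointwise slant submanifold with slant function $\theta$, $\theta(x)\in(0,\frac{\pi}{2}]$ for all $x\in M$, if, for every $x\in M$ and every nonzero $v\in T_xM$, the angle between $\bar Jv$ and $T_xM$ does not depend on $v$ but only on $x$; its value is $\theta(x)$. Equivalently, if $Tv$ is the component of $\bar Jv$ tangent to $M$, then $\Vert Tv\Vert^2=\cos^2\theta(x)\Vert v\Vert^2$ for all $v\in T_xM$. It is anti-invariant if $\theta$ is constantly equal to $\frac{\pi}{2}$. *)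

(* Defs.v *)
From HB Require Import structures.
From mathcomp Require Import all_boot all_order all_algebra.
From mathcomp Require Import all_classical all_reals all_analysis.

Set Implicit Arguments.
Unset Strict Implicit.
Unset Printing Implicit Defensive.

Import Order.TTheory GRing.Theory Num.Theory.
Import numFieldNormedType.Exports.
Local Open Scope classical_set_scope.
Local Open Scope ring_scope.

(* The library has no smooth manifolds; this file sets up the few notions of
   differential geometry needed, directly over the library's Frechet
   derivative. *)

Section SmoothOn.
Context {R : realType} {V W : normedModType R}.

(* Class C^k on a set U; only used with U open and V, W finite-dimensional,
   where differentiability together with C^(k-1) directional derivatives in
   all directions is the usual notion. *)
Fixpoint class_C (k : nat) (U : set V) (f : V -> W) : Prop :=
  match k with
  | 0 => {in U, continuous f}
  | k'.+1 => (forall x, U x -> differentiable f x) /\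
             (forall v, class_C k' U ('D_v f))
  end.

Definition smooth_on (U : set V) (f : V -> W) : Prop :=
  forall k, class_C k U f.

End SmoothOn.

(* A chart: a homeomorphism from the open set [cdom] onto its open image in
   R^n. Both maps are total functions, only meaningful on these
   sets. *)
Record chart (R : realType) (n : nat) (M : topologicalType) := Chart {
  cmap :> M -> 'rV[R]_n;
  cinv : 'rV[R]_n -> M;
  cdom : set M;
  cdom_open : open cdom;
  cimg_open : open (cmap @` cdom);
  cmapK : {in cdom, cancel cmap cinv};
  cmap_continuous : {in cdom, continuous cmap};
  cinv_continuous : {in cmap @` cdom, continuous cinv} }.

Record manifold (R : realType) (n : nat) := Manifold {
  msort :> topologicalType;
  atlas : set (chart R n msort);
  manifold_hausdorff : hausdorff_space msort;
  manifold_second_countable : @second_countable msort;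
  atlas_cover : forall x, exists2 c, atlas c & cdom c x;
  atlas_compatible : forall c d, atlas c -> atlas d ->
    smooth_on (c @` (cdom c `&` cdom d)) (d \o cinv c) }.

(* A chart of the atlas around x, chosen once and for all. *)
Definition chart_at (R : realType) (n : nat) (M : manifold R n) (x : M) :
    chart R n M :=
  s2val (cid2 (atlas_cover x)).

(* The tangent space at x. A tangent vector is represented by its components
   in the chart [chart_at x]; its components in any other chart c around x are
   obtained from these through the derivative of the change of charts, see
   [components]. *)
Definition tangent (R : realType) (n : nat) (M : manifold R n) (x : M) : Type :=
  'rV[R]_n.

HB.instance Definition _ (R : realType) (n : nat) (M : manifold R n) (x : M) :=
  Vector.copy (tangent x) 'rV[R]_n.

Section Manifold.
Context {R : realType} {n : nat} {M : manifold R n}.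

Definition smooth_fun (a : M -> R) : Prop :=
  forall c, atlas c -> smooth_on (c @` cdom c) (a \o cinv c : 'rV[R]_n -> R^o).

Definition components (c : chart R n M) (x : M) (v : tangent x) : 'rV[R]_n :=
  'd (c \o cinv (chart_at x)) (chart_at x x) v.

(* X is an element of Gamma(TM) *)
Definition smooth_field (X : forall x : M, tangent x) : Prop :=
  forall c, atlas c ->
    smooth_on (c @` cdom c) (fun y => components c (X (cinv c y))).

(* The smoothness of a tensor field is expressed, as is usual, by its action
   on smooth vector fields. *)
Record riemannian_metric (g : forall x : M, tangent x -> tangent x -> R) :
    Prop := {
  metric_linear : forall x u, scalar (g x u);
  metric_sym : forall x u v, g x u v = g x v u;
  metric_pos : forall x u, u != 0 -> 0 < g x u u;
  metric_smooth : forall X Y, smooth_field X -> smooth_field Y ->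
    smooth_fun (fun x => g x (X x) (Y x)) }.

Record almost_complex (J : forall x : M, 'End(tangent x)) : Prop := {
  complex_sqr : forall x, (J x \o J x)%VF = - \1%VF;
  complex_smooth : forall X, smooth_field X ->
    smooth_field (fun x => J x (X x)) }.

Record almost_hermitian (g : forall x : M, tangent x -> tangent x -> R)
    (J : forall x : M, 'End(tangent x)) : Prop := {
  hermitian_metric : riemannian_metric g;
  hermitian_complex : almost_complex J;
  hermitian_skew : forall x u v, g x (J x u) v = - g x u (J x v) }.

Definition Jcomb (a b : M -> R) (J1 J2 : forall x : M, 'End(tangent x)) :
    forall x : M, 'End(tangent x) :=
  fun x => a x *: J1 x + b x *: J2 x.

Definition angle (g : forall x : M, tangent x -> tangent x -> R) (x : M)
    (u v : tangent x) : R :=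
  acos (g x u v / (Num.sqrt (g x u u) * Num.sqrt (g x v v))).

End Manifold.

Section Immersed.
Context {R : realType} {m n : nat} {M : manifold R m} {N : manifold R n}.

Definition smooth_map (f : M -> N) : Prop :=
  continuous f /\
  forall c d, atlas c -> atlas d ->
    smooth_on (c @` (cdom c `&` f @^-1` cdom d)) (d \o f \o cinv c).

Definition differential (f : M -> N) (x : M) (v : tangent x) : tangent (f x) :=
  'd (chart_at (f x) \o f \o cinv (chart_at x)) (chart_at x x) v.

(* M is an immersed submanifold of N through f. T_xM is then identified with
   the range of [differential f x] in the tangent space of N at f x, and the
   induced metric is the restriction of that of N. *)
Definition injective_immersion (f : M -> N) : Prop :=
  [/\ smooth_map f, injective f & forall x, injective (differential f (x := x))].

Variables (g : forall p : N, tangent p -> tangent p -> R) (f : M -> N).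

(* The g-orthogonal projection of w to T_xM (the default 0 is never used when
   g is a metric). *)
Definition tangential (x : M) (w : tangent (f x)) : tangent (f x) :=
  xget 0 [set u | range (differential f (x := x)) u /\
                  forall v, g (w - u) (differential f v) = 0].

(* T_xM is identified with its image, so that T v, for v in T_xM, lives in the
   tangent space of the ambient manifold. *)
Definition tangential_J (J : forall p : N, 'End(tangent p)) (x : M)
    (v : tangent x) : tangent (f x) :=
  tangential (J (f x) (differential f v)).

(* The angle between w and T_xM: the least angle between w and a nonzero
   vector of T_xM. *)
Definition angle_with_tangent (x : M) (w : tangent (f x)) : R :=
  inf [set angle g w (differential f u) | u in [set u : tangent x | u != 0]].

Definition pointwise_slant (J : forall p : N, 'End(tangent p)) (theta : M -> R) :
    Prop :=
  forall x, 0 < theta x <= pi / 2 /\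
    forall v : tangent x, v != 0 ->
      angle_with_tangent (J (f x) (differential f v)) = theta x.

(* theta is *the* slant function. If M is 0-dimensional, the slant condition is
   vacuous and every function with values in ]0, pi/2] is a slant function, so
   uniqueness is only meaningful in positive dimension. *)
Definition the_slant_function (J : forall p : N, 'End(tangent p))
    (theta : M -> R) : Prop :=
  pointwise_slant J theta /\
  ((0 < m)%N -> forall theta', pointwise_slant J theta' -> theta' =1 theta).

End Immersed.

(* Main.v *)
Require Import Defs.
From HB Require Import structures.
From mathcomp Require Import all_boot all_order all_algebra.
From mathcomp Require Import all_classical all_reals all_analysis.
From mathcomp Require Import ring lra.
Import Order.TTheory GRing.Theory Num.Theory.
Import numFieldNormedType.Exports.
Local Open Scope classical_set_scope.
Local Open Scope ring_scope.

Set Implicit Arguments.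
Unset Strict Implicit.
Unset Printing Implicit Defensive.

(** Write T_i v for the tangential part of J_i v. When the submanifold is not
    a point, the cosine of the angle between a nonzero ambient vector w and
    T_xM is the ratio of the norm of the orthogonal projection of w to the
    norm of w ([angle_with_tangentE]). An almost Hermitian J is an isometry,
    so being pointwise slant with function theta means that |T v|^2 =
    cos^2 theta |v|^2 for all tangent v ([pointwise_slantP]).

    Anticommutation makes J_1 u and J_2 u orthogonal, hence a J_1 + b J_2 is
    again an isometry. The projection being linear, its tangential part is
    a T_1 + b T_2. Once T_1 v and T_2 v are orthogonal for every v,
      |a T_1 v + b T_2 v|^2 = (a^2 cos^2 theta_1 + b^2 cos^2 theta_2) |v|^2,
    where the factor is a convex combination of cos^2 theta_1 and
    cos^2 theta_2. It is the squared cosine of an angle theta between theta_1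
    and theta_2 because cos is decreasing on [0, pi] ([combined_angle],
    [slant_combination]).

    In part (i), T_1 = 0, so the orthogonality is trivial and theta is squeezed
    between two angles equal to pi/2. In part (ii), orthogonality is assumed
    for smooth vector fields on M only. It holds at each tangent vector v
    because v extends to a global smooth field ([exists_smooth_field]): spread
    v as a constant field over a chart, multiply by a bump function supported
    in a compact cube of that chart, and extend by zero, which is smooth since
    compact subsets of a Hausdorff space are closed. *)

(** * Differentiation and local equality, products *)

Section DifferentialCalculus.
Context {R : realType} {V W : normedModType R}.

(** Differentiability, unlike the existence and value of directional
    derivatives, is about a Landau remainder, which is transported along the
    local equality. *)
Lemma near_eq_is_diff (f g : V -> W) (x : V) :
  (\near x, f x = g x) -> differentiable f x -> is_diff x g ('d f x).
Proof.
move=> fg fx.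
have [dfc fxE] := (diff_locallyP x f).1 fx.
have gxE : g \o shift x = cst (g x) + 'd f x +o_ 0 id.
  apply/eqaddoP => e e0.
  have := (eqaddoP _ _ _ _).1 fxE e e0.
  have := fg; rewrite (near_shift 0) => fg0 fe.
  apply: filter_app fe; apply: filterS fg0 => z /=; rewrite subr0 => fgz.
  by rewrite !fctE /= fgz (nbhs_singleton fg).
have dgE : 'd g x = 'd f x :> (V -> W) by exact: diff_unique.
have gx : differentiable g x by apply/diff_locallyP; rewrite dgE; exact: conj.
exact: DiffDef gx dgE.
Qed.

Let scale (a : R^o) (w : W) := a *: w.

Let scale_is_bilinear :
  bilinear_for (GRing.Scale.Law.clone _ _ *:%R _)
    (GRing.Scale.Law.clone _ _ *:%R _) scale.
Proof.
split=> [w|a] x y z /=.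
- by rewrite /scale scalerDl scalerA.
- by rewrite /scale scalerDr !scalerA [_ * x]mulrC.
Qed.

Let scaleB : {bilinear R^o -> W -> W} :=
  HB.pack scale
    (bilinear_isBilinear.Build R R^o W W _ _ scale scale_is_bilinear).

(** The product rule, from the differential of the continuous bilinear map
    [scale] composed with the pair of p and F. *)
Lemma is_diff_scale (p dp : V -> R^o) (F dF : V -> W) (x : V) :
  is_diff x p dp -> is_diff x F dF ->
  is_diff x (fun y => p y *: F y) (fun v => dp v *: F x + p x *: dF v).
Proof.
move=> px Fx.
have cB : continuous (fun q : R^o * W => scaleB q.1 q.2).
  exact: scale_continuous.
have pF := is_diff_pair px Fx.
have sB : is_diff (p x, F x) (fun q => scaleB q.1 q.2)
    ('d (fun q => scaleB q.1 q.2) (p x, F x)).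
  by apply: differentiableP; exact: differentiable_bilin.
have := is_diff_comp pF sB.
rewrite diff_bilin// => h; apply: is_diff_eq h _.
by apply/funext => v /=; rewrite addrC.
Qed.

End DifferentialCalculus.

(** * Closure properties of the functions of class C^k *)

Section ClassC.
Context {R : realType} {V : normedModType R}.
Implicit Types (U : set V) (W : normedModType R).

Lemma class_CW W k U (f : V -> W) : class_C k.+1 U f -> class_C k U f.
Proof.
elim: k f => [|k IH] f [fd fD].
- by move=> x; rewrite inE => /fd; exact: differentiable_continuous.
- by split => // v; exact: IH.
Qed.

(** Derivatives of sums, products and composites are only computed on U, so
    each induction on k below passes through this lemma; openness of U makes
    the equality a local one, visible to the derivative. *)
Lemma eq_class_C W k U (f g : V -> W) : open U ->
  (forall x, U x -> f x = g x) -> class_C k U f -> class_C k U g.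
Proof.
move=> oU; elim: k f g => [|k IH] f g fg /=.
- move=> fc x xU; have Ux : U x by rewrite inE in xU.
  have nfg : \near x, f x = g x by apply: filterS (open_nbhs_nbhs (conj oU Ux)).
  rewrite /continuous_at -(fg _ Ux).
  by apply: cvg_trans (fc x xU); apply: near_eq_cvg.
- have nfg x : U x -> \near x, f x = g x.
    by move=> Ux; apply: filterS (open_nbhs_nbhs (conj oU Ux)).
  move=> [fd fD]; split => [x Ux|v].
    by have := near_eq_is_diff (nfg x Ux) (fd x Ux); case.
  apply: IH (fD v) => x Ux; exact: near_eq_derive (nfg x Ux).
Qed.

Lemma class_C_local W k U (f : V -> W) :
  (forall x, U x -> exists2 O, O x & class_C k O f) -> class_C k U f.
Proof.
elim: k f => [|k IH] f Uf /=.
- by move=> x; rewrite inE => /Uf [B Bx]; apply; rewrite inE.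
- split => [x /Uf [B Bx [+ _]]|v]; first by apply.
  by apply: IH => x /Uf [B Bx [_ fD]]; exists B => //; exact: fD.
Qed.

Lemma class_C_cst W k U (c : W) : open U -> class_C k U (fun=> c).
Proof.
move=> oU; elim: k c => [|k IH] c /=; first by move=> x _; exact: cvg_cst.
split => [x _|v]; first exact: differentiable_cst.
by apply: eq_class_C oU _ (IH 0) => x _; rewrite derive_cst.
Qed.

Lemma class_CD W k U (f g : V -> W) : open U ->
  class_C k U f -> class_C k U g -> class_C k U (fun x => f x + g x).
Proof.
move=> oU; elim: k f g => [|k IH] f g /=.
  by move=> fc gc x xU; apply: continuousD; [exact: fc | exact: gc].
move=> [fd fD] [gd gD]; split => [x Ux|v].
  by apply: differentiableD; [exact: fd | exact: gd].
apply: eq_class_C oU _ (IH _ _ (fD v) (gD v)) => x Ux.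
by rewrite deriveD//; apply: diff_derivable; [exact: fd | exact: gd].
Qed.

Lemma class_C_sum W k U (I : Type) (r : seq I) (F : I -> V -> W) : open U ->
  (forall i, class_C k U (F i)) -> class_C k U (fun x => \sum_(i <- r) F i x).
Proof.
move=> oU FC; elim: r => [|i r IH].
  by apply: eq_class_C oU _ (class_C_cst k 0 oU) => x _; rewrite big_nil.
by apply: eq_class_C oU _ (class_CD oU (FC i) IH) => x _; rewrite big_cons.
Qed.

Lemma class_C_scale W k U (p : V -> R^o) (f : V -> W) : open U ->
  class_C k U p -> class_C k U f -> class_C k U (fun x => p x *: f x).
Proof.
move=> oU; elim: k p f => [|k IH] p f.
  by move=> pc fc x xU; apply: cvgZ; [exact: pc | exact: fc].
move=> pC fC; have [[pd pD] [fd fD]] := (pC, fC).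
have pfd x : U x -> is_diff x (fun y => p y *: f y)
    (fun v => 'd p x v *: f x + p x *: 'd f x v).
  by move=> Ux; apply: is_diff_scale; apply: differentiableP; auto.
split => [x /pfd[//]|v].
have C1 := IH _ _ (pD v) (class_CW fC).
have C2 := IH _ _ (class_CW pC) (fD v).
apply: eq_class_C oU _ (class_CD oU C1 C2) => x Ux.
have pfx := pfd x Ux.
by rewrite (deriveE v (@ex_diff _ _ _ _ _ _ _ pfx)) diff_val !deriveE; auto.
Qed.

Lemma class_C_prod k U (I : Type) (r : seq I) (F : I -> V -> R^o) : open U ->
  (forall i, class_C k U (F i)) ->
  class_C k U (fun x => \prod_(i <- r) F i x : R^o).
Proof.
move=> oU FC; elim: r => [|i r IH].
  apply: eq_class_C oU _ (class_C_cst k (1 : R^o) oU) => x _.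
  by rewrite big_nil.
by apply: eq_class_C oU _ (class_C_scale oU (FC i) IH) => x _; rewrite big_cons.
Qed.

Lemma class_C_coord m k U (f : V -> 'rV[R]_m) (i : 'I_m) : open U ->
  class_C k U f -> class_C k U (fun x => f x 0 i : R^o).
Proof.
move=> oU; elim: k f => [|k IH] f /=.
  move=> fc x xU; apply: (@continuous_comp _ _ _ f (fun M : 'rV[R]_m => M 0 i)).
    exact: fc.
  exact: coord_continuous.
move=> [fd fD]; split => [x Ux|v].
  apply: (@differentiable_comp _ _ _ _ f (fun M : 'rV[R]_m => M 0 i : R^o)).
    exact: fd.
  exact: differentiable_coord.
apply: eq_class_C oU _ (IH _ (fD v)) => x Ux.
by rewrite derive_mx ?mxE//; apply: diff_derivable; exact: fd.
Qed.

(** The chain rule gives D_v (h o f) = sum_i (D_v f)_i (D_(e_i) h) o f, a sum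
    of products of functions that are one class less regular. *)
Lemma class_C_comp W m k U (O : set 'rV[R]_m) (f : V -> 'rV[R]_m)
    (h : 'rV[R]_m -> W) : open U -> (forall x, U x -> O (f x)) ->
  class_C k U f -> class_C k O h -> class_C k U (h \o f).
Proof.
move=> oU UO; elim: k h => [|k IH] h.
  move=> fc hc x xU; apply: continuous_comp; first exact: fc.
  by apply: hc; rewrite inE; apply: UO; rewrite inE in xU.
move=> fC hC; have [[fd fD] [hd hD]] := (fC, hC).
split => [x Ux|v].
  by apply: differentiable_comp; [exact: fd | exact/hd/UO].
have C i := class_C_scale oU (class_C_coord i oU (fD v))
  (IH _ (class_CW fC) (hD (delta_mx 0 i))).
apply: eq_class_C oU _ (class_C_sum (index_enum _) oU C) => x Ux.
have hdx := hd _ (UO x Ux); have fdx := fd x Ux.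
rewrite [in RHS]deriveE; last exact: differentiable_comp.
rewrite diff_comp//= -(deriveE v fdx).
rewrite [in RHS](row_sum_delta ('D_v f x)) linear_sum.
by apply: eq_bigr => i _; rewrite linearZ/= (deriveE _ hdx).
Qed.

End ClassC.

(** * Bump functions *)

Section FlatFunction.
Context {R : realType}.

(** The case n = 0 is the classical smooth function exp(-1/t), flat at 0. The
    powers of 1/t make the linear span of the family stable under derivation. *)
Definition flat (n : nat) (t : R) : R :=
  if 0 < t then t^-1 ^+ n * expR (- t^-1) else 0.

Lemma flat_gt0 n t : 0 < t -> 0 < flat n t.
Proof.
by move=> t0; rewrite /flat t0 mulr_gt0 ?expR_gt0// exprn_gt0// invr_gt0.
Qed.

Lemma flat_le0 n t : t <= 0 -> flat n t = 0.
Proof. by rewrite /flat ltNge => ->. Qed.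

(** With s = 1/t this is s^(n+2) <= (n+2)! exp(s), a single term of the
    exponential series. It makes [flat n] differentiable at 0 with derivative
    0. *)
Lemma flat_quadratic n t : `|flat n t| <= (n.+2)`!%:R * t ^+ 2.
Proof.
have [t0|t0] := ltP 0 t; last first.
  by rewrite flat_le0// normr0 mulr_ge0// sqr_ge0.
rewrite gtr0_norm ?flat_gt0// /flat t0 expRN.
set s := t^-1; have s0 : 0 < s by rewrite invr_gt0.
have -> : t = s^-1 by rewrite invrK.
rewrite ler_pdivrMr ?expR_gt0// [s^-1 ^+ 2]exprVn mulrAC.
rewrite ler_pdivlMr ?exprn_gt0//.
rewrite -exprD addn2 -ler_pdivrMl ?ltr0n ?fact_gt0// mulrC.
apply: le_trans (expR_ge1Dxn n.+1 (ltW s0)).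
by rewrite lerDr.
Qed.

Lemma is_derive_flat n (t : R) :
  is_derive t (1 : R) (flat n) (flat n.+2 t - n%:R * flat n.+1 t).
Proof.
have [t0|t0|->] := ltgtP t 0.
- rewrite !flat_le0 ?ltW// mulr0 subr0.
  apply: (near_eq_is_derive _ (is_derive_cst (0 : R) t 1)).
  by near=> y; rewrite flat_le0// ltW//; near: y; exact: lt_nbhsl.
- have tn0 : t != 0 by rewrite gt_eqF.
  have dV : is_derive t (1 : R) (fun u : R => u^-1) (- t ^- 2).
    apply: DeriveDef; first exact: derivableV.
    by rewrite deriveV// derive_id scaler1.
  have dX : is_derive t (1 : R) (fun u : R => u^-1 ^+ n)
      (- n%:R * t^-1 ^+ n.+1).
    have -> : (fun u : R => u^-1 ^+ n) = (fun u : R => u^-1) ^+ n.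
      by apply/funext => u; rewrite exprfctE.
    apply: is_derive_eq (is_deriveX n dV) _.
    case: n => [|n]; first by rewrite !mul0r oppr0 mul0r scale0r.
    by rewrite /GRing.scale/= -exprVn !exprS; ring.
  have dE : is_derive t (1 : R) (fun u : R => expR (- u^-1))
      (t^-1 ^+ 2 * expR (- t^-1)).
    have dN : is_derive t (1 : R) (fun u : R => - u^-1) (- - t ^- 2).
      exact: is_deriveN.
    apply: is_derive_eq (@is_derive1_comp _ expR (fun u : R => - u^-1) t _ _
      (is_derive_expR (- t^-1)) dN) _.
    by rewrite opprK exprVn mulrC.
  apply: near_eq_is_derive (is_derive_eq (is_deriveM dX dE) _).
    by near=> y; rewrite /flat ifT//; near: y; exact: lt_nbhsr.
  rewrite /flat t0 /GRing.scale/= !exprS; ring.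
- rewrite !flat_le0// mulr0 subr0.
  suff H : (fun h : R => h^-1 *:
      ((flat n \o shift 0) (h *: (1 : R)) - flat n 0)) @ 0^' --> (0 : R).
    by apply: DeriveDef; [apply/cvg_ex; exists 0 | exact: cvg_lim].
  apply/cvgr0Pnorm_le => e e0.
  set K : R := (n.+2)`!%:R; have K0 : 0 < K by rewrite ltr0n fact_gt0.
  near=> h.
  have h0 : h != 0 by near: h; exact: nbhs_dnbhs_neq.
  rewrite /= (@flat_le0 n 0)// subr0 addr0 normrM normfV [h *: _]mulr1.
  rewrite ler_pdivrMl ?normr_gt0//.
  apply: le_trans (flat_quadratic n h) _.
  rewrite -/K -real_normK ?num_real// expr2 mulrCA ler_pM2l ?normr_gt0//.
  rewrite mulrC -ler_pdivlMr//; near: h; apply: dnbhs0_le; exact: divr_gt0.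
Unshelve. all: by end_near. Qed.

End FlatFunction.

(** In each use l is affine: its differential dl does not depend on the point,
    so that derivatives stay in the span of the functions [flat m \o l]. *)
Lemma class_C_flat {R : realType} {V : normedModType R} (l dl : V -> R^o)
    (U : set V) n k : open U -> (forall x, is_diff x l dl) ->
  class_C k U (fun x => flat n (l x) : R^o).
Proof.
move=> oU l_diff.
have flat_diff m x : is_diff x (fun y => flat m (l y) : R^o)
    (fun v => dl v * (flat m.+2 (l x) - m%:R * flat m.+1 (l x))).
  have [fd fD] := is_derive_flat m (l x).
  have fdf : is_diff (l x) (flat m : R^o -> R^o)
      (fun h => h * (flat m.+2 (l x) - m%:R * flat m.+1 (l x))).
    apply: DiffDef; first exact/derivable1_diffP.
    by rewrite deriv1E// derive1E fD.
  exact: is_diff_comp (l_diff x) fdf.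
elim: k n => [|k IH] n.
  by move=> x _; apply: differentiable_continuous; case: (flat_diff n x).
split => [x _|v]; first by case: (flat_diff n x).
have C m := class_C_scale oU (class_C_cst k (dl v : R^o) oU) (IH m).
have C2 := class_C_scale oU (class_C_cst k (- n%:R : R^o) oU) (C n.+1).
apply: eq_class_C oU _ (class_CD oU (C n.+2) C2) => x _.
have fx := flat_diff n x.
rewrite (deriveE v (@ex_diff _ _ _ _ _ _ _ fx)) diff_val /GRing.scale/=; ring.
Qed.

Section Bump.
Context {R : realType} {m : nat}.
Implicit Types (a z : 'rV[R]_m) (r : R).

(** Positive exactly on the open cube of centre a and half-side r. *)
Definition bump a r z : R^o :=
  \prod_(i < m) (flat 0 (r - (z 0 i - a 0 i)) * flat 0 (r + (z 0 i - a 0 i))).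

Lemma bump_center a r : 0 < r -> bump a r a != 0.
Proof.
move=> r0; rewrite gt_eqF//; apply: prodr_gt0 => i _.
by rewrite subrr subr0 addr0 mulr_gt0// flat_gt0.
Qed.

Lemma bump_support a r z : bump a r z != 0 ->
  forall i, a 0 i - r <= z 0 i <= a 0 i + r.
Proof.
move=> /prodf_neq0 nz i; have := nz i isT; rewrite mulf_eq0 negb_or.
move=> /andP[/eqP n1 /eqP n2]; apply/andP; split.
- by rewrite leNgt; apply/negP => zi; apply: n2; apply: flat_le0; lra.
- by rewrite leNgt; apply/negP => zi; apply: n1; apply: flat_le0; lra.
Qed.

Lemma smooth_bump a r (U : set 'rV[R]_m) : open U -> smooth_on U (bump a r).
Proof.
move=> oU k; apply: class_C_prod => // i.
have coordE x : is_diff x (fun z : 'rV[R]_m => z 0 i : R^o)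
    (fun z => z 0 i : R^o).
  apply: DiffDef; first exact: differentiable_coord.
  apply/funext => v; rewrite -deriveE; last exact: differentiable_coord.
  have := derive_mx (@derivable_id _ _ x v); rewrite derive_id => {2}->.
  by rewrite mxE.
pose u z : R^o := z 0 i - a 0 i.
have uE x : is_diff x u (fun z => z 0 i : R^o).
  by apply: is_diff_eq (is_diffB (coordE x) (is_diff_cst (a 0 i : R^o) x)) _;
    apply/funext => v; rewrite !fctE subr0.
have u1 x : is_diff x (fun z => r - u z : R^o) (fun z => - z 0 i : R^o).
  by apply: is_diff_eq (is_diffB (is_diff_cst (r : R^o) x) (uE x)) _;
    apply/funext => v; rewrite !fctE sub0r.
have u2 x : is_diff x (fun z => r + u z : R^o) (fun z => z 0 i : R^o).
  by apply: is_diff_eq (is_diffD (is_diff_cst (r : R^o) x) (uE x)) _;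
    apply/funext => v; rewrite !fctE add0r.
exact: class_C_scale oU (class_C_flat 0 k oU u1) (class_C_flat 0 k oU u2).
Qed.

End Bump.

(** * Extending a tangent vector to a smooth vector field *)

Section Charts.
Context {R : realType} {n : nat} {M : manifold R n}.
Implicit Types (c d e : chart R n M) (x y : M).

Lemma chart_atP x : atlas (chart_at x) /\ cdom (chart_at x) x.
Proof. by rewrite /chart_at; case: cid2. Qed.

Lemma chartK c y : cdom c y -> cinv c (c y) = y.
Proof. by move=> cy; apply: (@cmapK _ _ _ c); rewrite inE. Qed.

Lemma open_chart_image c (A : set M) : open A -> open (c @` (cdom c `&` A)).
Proof.
move=> oA; rewrite openE => _ [y [cy Ay] <-].
have cimg : nbhs (c y) (c @` cdom c).
  by apply: open_nbhs_nbhs; split; [exact: cimg_open | exists y].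
have cA : nbhs (c y) (cinv c @^-1` A).
  apply: (@cinv_continuous _ _ _ c (c y)); first by rewrite inE; exists y.
  by rewrite chartK//; apply: open_nbhs_nbhs.
rewrite /interior; apply: filterS2 cimg cA => _ [w cw <-].
by rewrite /= chartK// => Aw; exists w.
Qed.

Lemma transition_diff c d y : atlas c -> atlas d -> cdom c y -> cdom d y ->
  differentiable (d \o cinv c) (c y).
Proof.
move=> ac ad cy dy; have [+ _] := atlas_compatible ac ad 1.
by apply; exists y.
Qed.

(** The cocycle relation of the tangent bundle: it makes the components, in a
    chart e, of the field that has constant components v in the chart c
    independent of the intermediate chart d. *)
Lemma transition_chain c d e y (v : 'rV[R]_n) : atlas c -> atlas d -> atlas e ->
    cdom c y -> cdom d y -> cdom e y ->
  'd (e \o cinv d) (d y) ('d (d \o cinv c) (c y) v) = 'd (e \o cinv c) (c y) v.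
Proof.
move=> ac ad ae cy dy ey.
have dcd := transition_diff ac ad cy dy.
have dde := transition_diff ad ae dy ey.
have dcy : (d \o cinv c) (c y) = d y by rewrite /= chartK.
rewrite -dcy in dde.
have eqn : \forall z \near c y,
    ((e \o cinv d) \o (d \o cinv c)) z = (e \o cinv c) z.
  have : nbhs (c y) (c @` (cdom c `&` cdom d)).
    apply: open_nbhs_nbhs; split; last by exists y.
    by apply: open_chart_image; exact: cdom_open.
  by apply: filterS => _ [w [cw dw] <-]; rewrite /= chartK// chartK.
have [_ dE] := near_eq_is_diff eqn (differentiable_comp dcd dde).
have := congr1 (fun h => h v) (diff_comp dcd dde).
rewrite [RHS]/= (chartK cy) => chain; apply: etrans (esym chain) _.
exact: esym (congr1 (fun h => h v) dE).
Qed.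

Lemma transition_id c y (v : 'rV[R]_n) : cdom c y ->
  'd (c \o cinv c) (c y) v = v.
Proof.
move=> cy.
have eqn : \forall z \near c y, id z = (c \o cinv c) z.
  have : nbhs (c y) (c @` cdom c).
    by apply: open_nbhs_nbhs; split; [exact: cimg_open | exists y].
  by apply: filterS => _ [w cw <-]; rewrite /= chartK.
have [_ ->] := near_eq_is_diff eqn (@ex_diff _ _ _ _ _ _ _ (is_diff_id (c y))).
by rewrite (@diff_val _ _ _ _ _ _ _ (is_diff_id (c y))).
Qed.

(** The field is the constant vector w in the chart c around x, multiplied by a
    bump function. In another chart d, over the domain of c, it is the product
    of two smooth functions composed with the change of charts: the bump
    function and D_w (d o c^-1). Outside the compact image K of the supporting
    cube, it vanishes. The domain of c and the complement of K cover M. *)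
Lemma exists_smooth_field x (v : tangent x) :
  exists2 X : forall y : M, tangent y, smooth_field X & X x = v.
Proof.
set c := chart_at x; have [ac cx] : atlas c /\ cdom c x := chart_atP x.
have /nbhs_ballP[e /= e0 xe] : nbhs (c x) (c @` cdom c).
  by apply: open_nbhs_nbhs; split; [exact: cimg_open | exists x].
set r := e / 2; have r0 : 0 < r by rewrite divr_gt0.
pose Q := [set z : 'rV[R]_n |
  forall i, `[c x 0 i - r, c x 0 i + r]%classic (z 0 i)].
have Qc : Q `<=` c @` cdom c.
  move=> z Qz; apply: xe; split=> // i j; rewrite ord1.
  have := Qz j; rewrite /= in_itv/= /r => /andP[zl zu].
  by rewrite -ball_normE /= ltr_norml; apply/andP; split; lra.
have Kcl : closed (cinv c @` Q).
  apply: compact_closed; first exact: manifold_hausdorff.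
  apply: continuous_compact.
    apply: continuous_in_subspaceT => z; rewrite inE => /Qc cz.
    by apply: (@cinv_continuous _ _ _ c); rewrite inE.
  apply: (@rV_compact _ _ (fun i => `[c x 0 i - r, c x 0 i + r]%classic)) => i.
  exact: segment_compact.
(* The value of the bump function at its centre is positive, not 1. *)
pose w := (bump (c x) r (c x))^-1 *: (v : 'rV[R]_n).
pose X y : tangent y := if pselect (cdom c y) then
  bump (c x) r (c y) *: 'd (chart_at y \o cinv c) (c y) w else 0.
exists X; last first.
  rewrite /X; case: pselect => // ?; rewrite -/c transition_id//.
  by rewrite /w scalerA divff ?scale1r// bump_center.
move=> d ad k; apply: class_C_local => _ [y dy <-].
have [cy|ncy] := pselect (cdom c y).
  exists (d @` (cdom d `&` cdom c)); first by exists y.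
  have oU : open (d @` (cdom d `&` cdom c)) by exact/open_chart_image/cdom_open.
  have oO : open (c @` (cdom c `&` cdom d)) by exact/open_chart_image/cdom_open.
  have UO z : (d @` (cdom d `&` cdom c)) z ->
      (c @` (cdom c `&` cdom d)) ((c \o cinv d) z).
    by move=> [u [du cu] <-]; exists u => //=; rewrite chartK.
  have trC := atlas_compatible ad ac k.
  have bC := class_C_comp oU UO trC (smooth_bump (c x) r oO k).
  have [_ /(_ w) DC] := atlas_compatible ac ad k.+1.
  apply: eq_class_C oU _ (class_C_scale oU bC (class_C_comp oU UO trC DC)).
  move=> _ [u [du cu] <-]; rewrite /= chartK// /components /X.
  case: pselect => // ?; have [au uu] := chart_atP u.
  rewrite linearZ/= transition_chain// deriveE//.
  exact: transition_diff.
exists (d @` (cdom d `&` ~` (cinv c @` Q))).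
  exists y => //; split => // -[z Qz zy]; apply: ncy.
  by have [u cu uz] := Qc _ Qz; rewrite -zy -uz chartK.
have oU : open (d @` (cdom d `&` ~` (cinv c @` Q))).
  by apply: open_chart_image; exact: closed_openC.
apply: eq_class_C oU _ (class_C_cst k 0 oU) => _ [u [du uQ] <-].
rewrite chartK// /components /X.
case: pselect => [cu|?]; last by rewrite linear0.
rewrite (_ : bump _ _ _ = 0) ?scale0r ?linear0//; apply/eqP; apply/negPn/negP.
by move=> /bump_support Qu; apply: uQ; exists (c u); rewrite ?chartK.
Qed.

End Charts.

(** * Inner products and orthogonal projection *)

Section InnerProduct.
Context {R : realType} {V : lmodType R} (b : V -> V -> R).
Hypothesis b_linear : forall u, scalar (b u).
Hypothesis b_sym : forall u v, b u v = b v u.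
Hypothesis b_pos : forall u, u != 0 -> 0 < b u u.

Let b0r u : b u 0 = 0.
Proof. by have := b_linear u (-1) 0 0; rewrite scaler0 addr0 mulN1r addNr. Qed.

Lemma ip_lin k l u v w : b w (k *: u + l *: v) = k * b w u + l * b w v.
Proof. by rewrite b_linear -[l *: v]addr0 b_linear b0r addr0. Qed.

Lemma ipBl u v w : b (u - v) w = b u w - b v w.
Proof.
rewrite b_sym -[X in X - v]scale1r -scaleN1r ip_lin !(b_sym w); ring.
Qed.

Lemma ip_quad k l u v :
  b (k *: u + l *: v) (k *: u + l *: v) =
  k ^+ 2 * b u u + (k * l * b u v) *+ 2 + l ^+ 2 * b v v.
Proof.
rewrite ip_lin !(b_sym (k *: u + l *: v)) !ip_lin (b_sym v u); ring.
Qed.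

Lemma ip_ge0 u : 0 <= b u u.
Proof. by have [->|/b_pos/ltW//] := eqVneq u 0; rewrite b0r. Qed.

Lemma ip_eq0 u : b u u = 0 -> u = 0.
Proof.
move=> uu0; apply/eqP; apply/negPn/negP => /b_pos.
by rewrite uu0 ltxx.
Qed.

Lemma ip_cauchy_schwarz u v : b u v <= Num.sqrt (b u u) * Num.sqrt (b v v).
Proof.
have [->|/b_pos v0] := eqVneq v 0; first by rewrite !b0r sqrtr0 mulr0.
apply: le_trans (ler_norm _) _.
(* The vector |v|^2 u - (u.v) v has squared norm
   |v|^2 (|u|^2 |v|^2 - (u.v)^2). *)
rewrite -(@ler_pXn2r _ 2)// ?nnegrE ?mulr_ge0 ?sqrtr_ge0//.
rewrite exprMn !sqr_sqrtr ?ip_ge0// real_normK ?num_real//.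
have := ip_ge0 (b v v *: u + (- b u v) *: v); rewrite ip_quad => H.
rewrite -subr_ge0 -(pmulr_rge0 _ v0); apply: le_trans H _.
rewrite le_eqVlt; apply/orP; left; apply/eqP; ring.
Qed.

(** The coordinates s of the projection solve s G = (b w (D e_j))_j, where G is
    the Gram matrix of the vectors D e_i; G is invertible since s G = 0 makes
    D s orthogonal to itself. *)
Lemma ip_projection m (D : {linear 'rV[R]_m -> V}) : injective D ->
  forall w, exists s, forall t, b (w - D s) (D t) = 0.
Proof.
move=> D_inj w.
pose G := \matrix_(i < m, j < m) b (D (delta_mx 0 i)) (D (delta_mx 0 j)).
have D_sum t : D t = \sum_i t 0 i *: D (delta_mx 0 i).
  rewrite [in LHS](row_sum_delta t) linear_sum.
  by apply: eq_bigr => i _; exact: linearZ.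
have b_sum u (t : 'rV[R]_m) (F : 'I_m -> V) :
    b u (\sum_i t 0 i *: F i) = \sum_i t 0 i * b u (F i).
  elim/big_rec2: _ => [|i y z _ <-]; first exact: b0r.
  by rewrite b_linear.
have GE (s : 'rV[R]_m) j : (s *m G) 0 j = b (D s) (D (delta_mx 0 j)).
  rewrite mxE b_sym (D_sum s) b_sum; apply: eq_bigr => i _.
  by rewrite mxE b_sym.
have bD u s : (forall j, b u (D (delta_mx 0 j)) = 0) -> b u (D s) = 0.
  by move=> u0; rewrite D_sum b_sum big1// => i _; rewrite u0 mulr0.
have G_unit : G \in unitmx.
  rewrite -row_free_unit; apply/row_freeP/row_freeP; rewrite -kermx_eq0.
  apply/rowV0P => s /sub_kermxP sG; apply: D_inj; rewrite linear0.
  by apply: ip_eq0; apply: bD => j; rewrite -GE sG mxE.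
exists ((\row_j b w (D (delta_mx 0 j))) *m invmx G) => t; apply: bD => j.
by rewrite ipBl -GE mulmxKV// mxE subrr.
Qed.

End InnerProduct.

(** * Angles *)

Section Angles.
Context {R : realType}.
Implicit Types s t a b : R.

Lemma ler_cos s t : 0 <= s <= pi -> 0 <= t <= pi ->
  (cos t <= cos s) = (s <= t).
Proof. by move=> ss tt; rewrite !leNgt ltr_cos// in_itv. Qed.

(** The squared cosine of r is a convex combination of those of s and t, and
    all these cosines are nonnegative. *)
Lemma combined_angle s t a b : 0 < s <= pi / 2 -> 0 < t <= pi / 2 ->
  a ^+ 2 + b ^+ 2 = 1 ->
  exists r, [/\ 0 < r <= pi / 2,
    cos r ^+ 2 = a ^+ 2 * cos s ^+ 2 + b ^+ 2 * cos t ^+ 2 &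
    Num.min s t <= r <= Num.max s t].
Proof.
move=> + + ab.
wlog st : s t a b ab / s <= t.
  move=> W; have [st|ts] := orP (le_total s t); first exact: W.
  move=> ss tt; rewrite addrC in ab.
  have [r [r1 r2 r3]] := W _ _ _ _ ab ts tt ss.
  exists r; split=> //; first by rewrite r2 addrC.
  by move: r3; rewrite minC maxC min_r// max_l.
move=> /andP[s0 sp] /andP[t0 tp].
have p2 : pi / 2 <= pi :> R by have := pi_gt0 R; lra.
have ct0 : 0 <= cos t by apply: cos_ge0_pihalf; apply/andP; split; lra.
have cst : cos t <= cos s by rewrite ler_cos//; apply/andP; split; lra.
have cs1 := cos_le1 s.
have a2 := sqr_ge0 a; have b2 := sqr_ge0 b.
have cst2 : cos t ^+ 2 <= cos s ^+ 2.
  by rewrite ler_pXn2r// nnegrE (le_trans ct0).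
set q := a ^+ 2 * cos s ^+ 2 + b ^+ 2 * cos t ^+ 2.
have tq : cos t ^+ 2 <= q by rewrite /q; nra.
have qs : q <= cos s ^+ 2 by rewrite /q; nra.
have q0 : 0 <= q by exact: le_trans (sqr_ge0 _) tq.
have tq' : cos t <= Num.sqrt q by rewrite -(ger0_norm ct0) -sqrtr_sqr ler_sqrt.
have qs' : Num.sqrt q <= cos s.
  rewrite -[leRHS](ger0_norm (le_trans ct0 cst)) -sqrtr_sqr.
  by rewrite ler_sqrt ?sqr_ge0.
have q1 : -1 <= Num.sqrt q <= 1.
  apply/andP; split; last exact: le_trans cs1.
  by apply: le_trans (sqrtr_ge0 q); lra.
have [rp rE] := acos_def q1.
exists (acos (Num.sqrt q)).
have sr : s <= acos (Num.sqrt q).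
  by rewrite -ler_cos ?rE//; apply/andP; split; lra.
have rt : acos (Num.sqrt q) <= t.
  by rewrite -ler_cos ?rE//; apply/andP; split; lra.
rewrite rE sqr_sqrtr// min_l// max_r//; split => //; last by rewrite sr.
by rewrite (lt_le_trans s0 sr) (le_trans rt tp).
Qed.

End Angles.

(** * Slant submanifolds *)

Section Slant.
Context {R : realType} {m n : nat} {M : manifold R m} {N : manifold R n}.
Variables (g : forall p : N, tangent p -> tangent p -> R) (f : M -> N).
Hypothesis g_metric : riemannian_metric g.
Hypothesis f_inj : forall x, injective (differential f (x := x)).
Implicit Type J : forall p : N, 'End(tangent p).

Let g_lin p (u : tangent p) : scalar (g u).
Proof. exact: (Defs.metric_linear g_metric). Qed.
Let g_sym p (u v : tangent p) : g u v = g v u.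
Proof. exact: (Defs.metric_sym g_metric). Qed.
Let g_pos p (u : tangent p) : u != 0 -> 0 < g u u.
Proof. exact: (Defs.metric_pos g_metric). Qed.

Lemma tangentialP x (w : tangent (f x)) :
  range (differential f (x := x)) (tangential g w) /\
  forall v, g (w - tangential g w) (differential f v) = 0.
Proof.
rewrite /tangential; case: xgetP => [y _ []//|/= none].
have [s sP] := ip_projection (@g_lin (f x)) (@g_sym (f x)) (@g_pos (f x))
  (D := 'd (chart_at (f x) \o f \o cinv (chart_at x)) (chart_at x x))
  (@f_inj x) w.
by exfalso; apply: (none (differential f s)); split; [exists s | exact: sP].
Qed.

Lemma tangential_unique x (w u : tangent (f x)) :
  range (differential f (x := x)) u ->
  (forall v, g (w - u) (differential f v) = 0) -> tangential g w = u.
Proof.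
move=> [s _ su] uP; have [[t _ tu] tP] := tangentialP w.
have E : differential f (t - s) = tangential g w - u.
  by rewrite -tu -su /differential linearB.
apply/subr0_eq/(ip_eq0 (@g_pos (f x))).
rewrite -{2}E -[tangential g w - u](subrKA w) addrC -(opprB w).
by rewrite (ipBl (@g_lin (f x)) (@g_sym (f x))) uP tP subrr.
Qed.

Let g0r p (u : tangent p) : g u 0 = 0.
Proof. by have := g_lin u (-1) 0 0; rewrite scaler0 addr0 mulN1r addNr. Qed.

Let g0l p (u : tangent p) : g 0 u = 0.
Proof. by rewrite g_sym g0r. Qed.

Let g_cauchy_schwarz p (u v : tangent p) :
  g u v <= Num.sqrt (g u u) * Num.sqrt (g v v).
Proof. exact: (ip_cauchy_schwarz (@g_lin p) (@g_sym p) (@g_pos p)). Qed.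

Let g_norm_gt0 p (u : tangent p) : u != 0 -> 0 < Num.sqrt (g u u).
Proof. by move=> u0; rewrite sqrtr_gt0 g_pos. Qed.

Let differential_neq0 x (v : tangent x) : v != 0 -> differential f v != 0.
Proof.
by apply: contra_neq => Dv; apply: (@f_inj x); rewrite Dv /differential linear0.
Qed.

Lemma tangential_pair x (w : tangent (f x)) v :
  g w (differential f v) = g (tangential g w) (differential f v).
Proof.
have [_ /(_ v)] := tangentialP w.
by rewrite (ipBl (@g_lin (f x)) (@g_sym (f x))) => /subr0_eq.
Qed.

Lemma tangential_lin x (k l : R) (w z : tangent (f x)) :
  tangential g (k *: w + l *: z) = k *: tangential g w + l *: tangential g z.
Proof.
have [[s _ sw] wP] := tangentialP w; have [[t _ tz] zP] := tangentialP z.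
apply: tangential_unique.
  exists (k *: s + l *: t) => //; rewrite -sw -tz /differential.
  by rewrite linearP linearZ.
move=> v; rewrite (ipBl (@g_lin (f x)) (@g_sym (f x))).
rewrite !(g_sym _ (differential f v)).
rewrite !(ip_lin (@g_lin (f x))) !(g_sym (differential f v)).
by rewrite (tangential_pair w) (tangential_pair z) subrr.
Qed.

Lemma tangential_norm_le x (w : tangent (f x)) :
  Num.sqrt (g (tangential g w) (tangential g w)) <= Num.sqrt (g w w).
Proof.
set tw := tangential g w.
have [->|tw0] := eqVneq tw 0; first by rewrite g0r sqrtr0 sqrtr_ge0.
have [[s _ stw] _] := tangentialP w.
rewrite -(ler_pM2r (g_norm_gt0 tw0)) -expr2.
rewrite sqr_sqrtr; last by rewrite ltW// g_pos.
have E := tangential_pair w s; rewrite stw -/tw in E.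
by rewrite -[X in X <= _]E; exact: g_cauchy_schwarz.
Qed.

(** For u tangent, g w u = g (tangential w) u, which by Cauchy-Schwarz is at
    most |tangential w| |u|, with equality at u = tangential w; if the latter
    is 0, every tangent u is orthogonal to w. In dimension 0 the infimum is
    over the empty set, hence the condition on m. *)
Lemma angle_with_tangentE x (w : tangent (f x)) : (0 < m)%N -> w != 0 ->
  angle_with_tangent g w =
  acos (Num.sqrt (g (tangential g w) (tangential g w)) / Num.sqrt (g w w)).
Proof.
move=> m0 w0; set W := Num.sqrt (g w w).
have W0 : 0 < W by rewrite sqrtr_gt0 g_pos.
set tw := tangential g w; set q := Num.sqrt (g tw tw) / W.
have gN (u v : tangent (f x)) : g u (- v) = - g u v.
  have := ip_lin (@g_lin (f x)) (-1) 0 v v u.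
  by rewrite scale0r addr0 scaleN1r mul0r addr0 mulN1r.
have CSN (u v : tangent (f x)) :
    - (Num.sqrt (g u u) * Num.sqrt (g v v)) <= g u v.
  rewrite lerNl -gN; apply: le_trans (g_cauchy_schwarz _ _) _.
  by rewrite gN g_sym gN opprK.
have range_q (u : tangent x) : u != 0 ->
    -1 <= g w (differential f u) /
      (W * Num.sqrt (g (differential f u) (differential f u))) <= q.
  move=> u0; have D0 := g_norm_gt0 (differential_neq0 u0).
  rewrite ler_pdivlMr ?mulr_gt0// mulN1r CSN/= ler_pdivrMr ?mulr_gt0//.
  rewrite /q -mulrA (mulKf (lt0r_neq0 W0)) tangential_pair.
  exact: g_cauchy_schwarz.
have q0 : 0 <= q by rewrite divr_ge0// sqrtr_ge0.
have q1 : q <= 1 by rewrite ler_pdivrMr// mul1r tangential_norm_le.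
have q11 : -1 <= q <= 1 by rewrite q1 andbT (le_trans _ q0)// lerN10.
have [q_itv q_cos] := acos_def q11.
have [u0 u0_neq0 u0E] : exists2 u : tangent x,
    u != 0 & angle g w (differential f u) = acos q.
  have [tw0|tw0] := eqVneq tw 0.
    have e0 : const_mx 1 != 0 :> 'rV[R]_m.
      apply/eqP => /rowP/(_ (Ordinal m0)); rewrite !mxE.
      by apply/eqP; exact: oner_neq0.
    exists (const_mx 1 : 'rV[R]_m) => //.
    by rewrite /angle tangential_pair /q -/tw tw0 !g0l sqrtr0 !mul0r.
  have [[s _ stw] _] := tangentialP w.
  exists s.
    by apply: contra_neq tw0 => s0; rewrite /tw -stw s0 /differential linear0.
  rewrite /angle tangential_pair stw -/tw -/W /q; congr acos.
  have t0 := g_norm_gt0 tw0.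
  rewrite -[X in X / _]sqr_sqrtr; last by rewrite ltW// g_pos.
  by field; rewrite !gt_eqF.
rewrite /angle_with_tangent; apply/eqP; rewrite eq_le; apply/andP; split.
  apply: ge_inf; last by exists u0.
  exists 0 => _ [u /= un0 <-]; have /andP[q1u qu] := range_q u un0.
  by rewrite /angle acos_ge0// q1u (le_trans qu).
apply: lb_le_inf; first by exists (angle g w (differential f u0)); exists u0.
move=> _ [u /= un0 <-]; have /andP[q1u qu] := range_q u un0.
rewrite /angle -/W; set p := _ / _ in q1u qu *.
have p11 : -1 <= p <= 1 by rewrite q1u (le_trans qu).
have [p_itv p_cos] := acos_def p11.
by rewrite -ler_cos// q_cos p_cos.
Qed.

(** For an isometry J the ratio of [angle_with_tangentE] at w = J v is
    |T v| / |v|. *)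
Lemma pointwise_slantP J (theta : M -> R) :
  (forall p (u : tangent p), g (J p u) (J p u) = g u u) ->
  pointwise_slant g f J theta <->
  forall x, 0 < theta x <= pi / 2 /\ forall v : tangent x,
    g (tangential_J g f J v) (tangential_J g f J v) =
    cos (theta x) ^+ 2 * g (differential f v) (differential f v).
Proof.
move=> Jiso.
have t0 x : tangential g (0 : tangent (f x)) = 0.
  by have := tangential_lin 0 0 (0 : tangent (f x)) 0; rewrite !scale0r addr0.
have pi2 : pi / 2 <= pi :> R by have := pi_gt0 R; lra.
suff H x : 0 < theta x <= pi / 2 ->
    (forall v : tangent x, v != 0 ->
      angle_with_tangent g (J (f x) (differential f v)) = theta x) <->
    (forall v : tangent x, g (tangential_J g f J v) (tangential_J g f J v) =
    cos (theta x) ^+ 2 * g (differential f v) (differential f v)).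
  by split=> S x; have [t1 t2] := S x; split=> //; apply/H.
move=> /andP[th0 thp].
have c0 : 0 <= cos (theta x) by apply: cos_ge0_pihalf; apply/andP; split; lra.
have thE : acos (cos (theta x)) = theta x.
  by apply: cosK; rewrite in_itv/=; apply/andP; split; lra.
suff H (v : tangent x) : v != 0 ->
     angle_with_tangent g (J (f x) (differential f v)) = theta x <->
     g (tangential_J g f J v) (tangential_J g f J v) =
    cos (theta x) ^+ 2 * g (differential f v) (differential f v).
  split=> S v; last by move=> v0; apply/H.
  have [->|v0] := eqVneq v 0; last by apply/H => //; exact: S.
  by rewrite /tangential_J /differential !linear0 t0 !g0r mulr0.
move=> v0.
have Dv0 := differential_neq0 v0.
have gD0 := g_pos Dv0.
have m0 : (0 < m)%N.
  case: (posnP m) => // m0; move: v0; rewrite (_ : v = 0) ?eqxx//.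
  by apply/rowP => -[i im]; exfalso; rewrite m0 in im.
have Jv0 : J (f x) (differential f v) != 0.
  by apply: contraTneq gD0 => J0; rewrite -Jiso J0 g0r ltxx.
rewrite angle_with_tangentE// Jiso -/(tangential_J g f J v).
set T := tangential_J _ _ _ _; set d := g (differential f v) _.
have T0 : 0 <= g T T by exact: (ip_ge0 (@g_lin (f x)) (@g_pos (f x))).
have d0 : 0 < Num.sqrt d by rewrite sqrtr_gt0.
split=> [E|->]; last first.
  by rewrite sqrtrM ?sqr_ge0// sqrtr_sqr ger0_norm// mulfK ?gt_eqF.
have /acos_def[_] : -1 <= Num.sqrt (g T T) / Num.sqrt d <= 1.
  rewrite ler_pdivrMr// mul1r (le_trans (tangential_norm_le _)) ?Jiso// andbT.
  by rewrite (le_trans _ (divr_ge0 _ _)) ?sqrtr_ge0// lerN10.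
rewrite E => ->; rewrite expr_div_n (sqr_sqrtr T0) (sqr_sqrtr (ltW gD0)).
by rewrite divfK// gt_eqF.
Qed.

Lemma slant_function_unique J (theta theta' : M -> R) : (0 < m)%N ->
  pointwise_slant g f J theta -> pointwise_slant g f J theta' ->
  theta' =1 theta.
Proof.
move=> m0 S S' x; have [_ Sx] := S x; have [_ Sx'] := S' x.
have e0 : (const_mx 1 : 'rV[R]_m) != 0.
  by apply/eqP => /rowP/(_ (Ordinal m0)); rewrite !mxE; apply/eqP/oner_neq0.
by rewrite -(Sx _ e0) -(Sx' _ e0).
Qed.

Lemma hermitian_isometry J : almost_hermitian g J ->
  forall p (u : tangent p), g (J p u) (J p u) = g u u.
Proof.
move=> [_ [Jsqr _] Jskew] p u.
have JJ : J p (J p u) = - u.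
  by have := congr1 (fun h : 'End(tangent p) => h u) (Jsqr p);
    rewrite comp_lfunE opp_lfunE id_lfunE.
rewrite Jskew JJ -[X in g u X]scaleN1r -[_ *: u]addr0 g_lin g0r; ring.
Qed.

Section Combination.
Variables (J1 J2 : forall p : N, 'End(tangent p)) (a b : N -> R).
Hypothesis J1_hermitian : almost_hermitian g J1.
Hypothesis J2_hermitian : almost_hermitian g J2.
Hypothesis J_anticomm : forall p, (J1 p \o J2 p)%VF = - (J2 p \o J1 p)%VF.
Hypothesis ab1 : forall p, a p ^+ 2 + b p ^+ 2 = 1.

Lemma JcombE p (u : tangent p) :
  Jcomb a b J1 J2 p u = a p *: J1 p u + b p *: J2 p u.
Proof. by rewrite /Jcomb add_lfunE !scale_lfunE. Qed.

(** g (J1 u) (J2 u) = - g u (J1 (J2 u)) = g u (J2 (J1 u))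
    = - g (J2 u) (J1 u). *)
Lemma anticomm_orthogonal p (u : tangent p) : g (J1 p u) (J2 p u) = 0.
Proof.
have J12 : J1 p (J2 p u) = - J2 p (J1 p u).
  by have := congr1 (fun h : 'End(tangent p) => h u) (J_anticomm p);
    rewrite opp_lfunE !comp_lfunE.
have [_ _ skew1] := J1_hermitian; have [_ _ skew2] := J2_hermitian.
have : g (J1 p u) (J2 p u) = - g (J1 p u) (J2 p u).
  rewrite {1}skew1 J12 -[X in g u X]scaleN1r -[_ *: (J2 p _)]addr0 g_lin g0r.
  rewrite g_sym skew2; lra.
lra.
Qed.

Lemma Jcomb_isometry p (u : tangent p) :
  g (Jcomb a b J1 J2 p u) (Jcomb a b J1 J2 p u) = g u u.
Proof.
rewrite JcombE (ip_quad (@g_lin p) (@g_sym p)) anticomm_orthogonal.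
rewrite !hermitian_isometry//.
by rewrite mulr0 mul0rn addr0 -mulrDl ab1 mul1r.
Qed.

(** Both parts of the theorem are instances of this pointwise statement. *)
Lemma slant_combination (theta1 theta2 : M -> R) :
  pointwise_slant g f J1 theta1 -> pointwise_slant g f J2 theta2 ->
  (forall x (v : tangent x),
    g (tangential_J g f J1 v) (tangential_J g f J2 v) = 0) ->
  exists theta, the_slant_function g f (Jcomb a b J1 J2) theta /\
    forall x, Num.min (theta1 x) (theta2 x) <= theta x
              <= Num.max (theta1 x) (theta2 x).
Proof.
move=> /(pointwise_slantP _ (hermitian_isometry J1_hermitian)) S1.
move=> /(pointwise_slantP _ (hermitian_isometry J2_hermitian)) S2 orth.
have /choice[theta thetaP] x :
    exists r, [/\ 0 < r <= pi / 2,
      cos r ^+ 2 = a (f x) ^+ 2 * cos (theta1 x) ^+ 2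
                 + b (f x) ^+ 2 * cos (theta2 x) ^+ 2 &
      Num.min (theta1 x) (theta2 x) <= r <= Num.max (theta1 x) (theta2 x)].
  have [t1 _] := S1 x; have [t2 _] := S2 x.
  exact: combined_angle t1 t2 (ab1 (f x)).
have S : pointwise_slant g f (Jcomb a b J1 J2) theta.
  apply/(pointwise_slantP _ Jcomb_isometry) => x.
  have [tx ctx _] := thetaP x; split=> // v.
  have [_ S1v] := S1 x; have [_ S2v] := S2 x.
  rewrite /tangential_J JcombE tangential_lin.
  rewrite (ip_quad (@g_lin (f x)) (@g_sym (f x))).
  rewrite -!/(tangential_J _ _ _ _) orth S1v S2v ctx; ring.
exists theta; split; last by move=> x; have [] := thetaP x.
by split=> // m0 theta' S'; exact: slant_function_unique m0 S S'.
Qed.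

End Combination.

End Slant.

Theorem mainTheorem5 (R : realType) (n m : nat)
    (Mbar : manifold R n) (g : forall p : Mbar, tangent p -> tangent p -> R)
    (J1 J2 : forall p : Mbar, 'End(tangent p))
    (g_metric : riemannian_metric g)
    (J1_hermitian : almost_hermitian g J1)
    (J2_hermitian : almost_hermitian g J2)
    (J_anticomm : forall p, (J1 p \o J2 p)%VF = - (J2 p \o J1 p)%VF)
    (M : manifold R m) (f : M -> Mbar) (f_immersion : injective_immersion f)
    (theta1 theta2 : M -> R)
    (slant1 : pointwise_slant g f J1 theta1)
    (slant2 : pointwise_slant g f J2 theta2)
    (a b : Mbar -> R) (a_smooth : smooth_fun a) (b_smooth : smooth_fun b)
    (ab1 : forall p, a p ^+ 2 + b p ^+ 2 = 1) :
  ((forall x, theta1 x = pi / 2) -> (forall x, theta2 x = pi / 2) ->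
    exists theta, the_slant_function g f (Jcomb a b J1 J2) theta /\
      forall x, theta x = pi / 2)
  /\
  ((forall X : (forall x : M, tangent x), smooth_field X -> forall x,
      g (f x) (tangential_J g f J1 (X x)) (tangential_J g f J2 (X x)) = 0) ->
    exists theta, the_slant_function g f (Jcomb a b J1 J2) theta /\
      forall x, Num.min (theta1 x) (theta2 x) <= theta x
                <= Num.max (theta1 x) (theta2 x)).
Proof.
have [_ _ f_inj] := f_immersion.
split=> [th1 th2|orth].
  have [|theta [thetaS thetaE]] := slant_combination g_metric f_inj J1_hermitian
      J2_hermitian J_anticomm ab1 slant1 slant2.
    move=> x v.
    have [_ /(_ v)] := (pointwise_slantP g_metric f_inj _
      (hermitian_isometry g_metric J1_hermitian)).1 slant1 x.
    rewrite th1 cos_pihalf expr0n mul0r.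
    move=> /(ip_eq0 (Defs.metric_pos g_metric (x := f x))) ->.
    have := Defs.metric_linear g_metric (tangential_J g f J2 v) (-1) 0 0.
    rewrite (Defs.metric_sym g_metric).
    by rewrite scaler0 addr0 mulN1r addNr.
  exists theta; split=> // x; have := thetaE x.
  by rewrite th1 th2 minxx maxxx => /le_anti.
apply: slant_combination => // x v.
by have [X X_smooth <-] := exists_smooth_field v; exact: orth.
Qed.
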